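(* Let $m<n$ be positive integers and let $\eta: B_m \to B_n$ be the standard geometric embedding, i.e. the injective homomorphism determined by $\eta(\sigma_i)=\sigma_i$ for $i=1,\ldots,m-1$. For every $a,b\in B_m$, if $\eta(a)$ and $\eta(b)$ are conjugate in $B_n$, then $a$ and $b$ are conjugate in $B_m$.
   Context: $B_n$ denotes the braid group on $n$ strands, with Artin presentation having generators $\sigma_1,\ldots,\sigma_{n-1}$ and relations $\sigma_i\sigma_j=\sigma_j\sigma_i$ for $|i-j|>1$ and $\sigma_i\sigma_j\sigma_i=\sigma_j\sigma_i\sigma_j$ for $|i-j|=1$. Equivalently, $B_n = MCG(\mathbb D_n,\partial \mathbb D_n)$ is the group of isotopy classes of orientation-preserving homeomorphisms of the $n$-times punctured disc $\mathbb D_n$ fixing the boundary pointwise. The standard embedding of discs $\eta:\mathbb D_m\to\mathbb D_n$ is the inclusion, in the complex plane, of the $m$-times punctured disc of diameter $m-1/2$ with punctures $1,\ldots,m$ into the $n$-times punctured disc of diameter $n$ with punctures $1,\ldots,n$ (each disc being centred so that it contains its punctures in its interior and the smaller disc lies in the interior of the larger one). The standard geometric embedding $\eta:B_m\to B_n$ is induced by extending each homeomorphism of $\eta(\mathbb D_m)$ by the identity to $\mathbb D_n$; in terms of Artin generators, $\eta(\sigma_i)=\sigma_i$ for $i=1,\ldots,m-1$ (i.e. it adds $n-m$ trivial strands to the right of each braid). *)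

(* Defs.v *)
From HB Require Import structures.
From mathcomp Require Import all_boot.
From mathcomp Require Import boolp.

Set Implicit Arguments.
Unset Strict Implicit.
Unset Printing Implicit Defensive.

Local Open Scope quotient_scope.
Local Open Scope group_scope.

(* The Artin generators sigma_1, ..., sigma_(n-1) are indexed from 0 by
   'I_n.-1; the letter (i, b) stands for the i-th generator if b = true and for
   its inverse if b = false. *)
Definition braid_word (n : nat) := seq ('I_n.-1 * bool).

HB.instance Definition _ n := Choice.on (braid_word n).

Inductive braid_equiv (n : nat) : braid_word n -> braid_word n -> Prop :=
| BraidRefl u : braid_equiv u u
| BraidSym u v : braid_equiv u v -> braid_equiv v u
| BraidTrans u v w : braid_equiv u v -> braid_equiv v w -> braid_equiv u w
| BraidCat u u' v v' :
    braid_equiv u u' -> braid_equiv v v' -> braid_equiv (u ++ v) (u' ++ v')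
| BraidCancel i b : braid_equiv [:: (i, b); (i, ~~ b)] [::]
| BraidFar (i j : 'I_n.-1) :
    (i.+1 < j) || (j.+1 < i) ->
    braid_equiv [:: (i, true); (j, true)] [:: (j, true); (i, true)]
| BraidNear (i j : 'I_n.-1) :
    (i.+1 == j) || (j.+1 == i) ->
    braid_equiv [:: (i, true); (j, true); (i, true)]
                [:: (j, true); (i, true); (j, true)].

Definition braid_equivb (n : nat) : rel (braid_word n) :=
  fun u v => `[< braid_equiv u v >].

Fact braid_equivb_refl n : reflexive (@braid_equivb n).
Proof. by move=> u; apply/asboolP; exact: BraidRefl. Qed.

Fact braid_equivb_sym n : symmetric (@braid_equivb n).
Proof.
by move=> u v; apply/asboolP/asboolP; exact: BraidSym.
Qed.

Fact braid_equivb_trans n : transitive (@braid_equivb n).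
Proof.
move=> v u w /asboolP uv /asboolP vw; apply/asboolP.
exact: BraidTrans uv vw.
Qed.

Canonical braid_equiv_rel (n : nat) :=
  EquivRel (@braid_equivb n) (@braid_equivb_refl n) (@braid_equivb_sym n)
           (@braid_equivb_trans n).

Definition braid (n : nat) := {eq_quot (@braid_equivb n)}.

HB.instance Definition _ n := Choice.on (braid n).

Definition braid_of_word (n : nat) (u : braid_word n) : braid n := \pi u.

Lemma braid_of_wordP n (u v : braid_word n) :
  braid_of_word u = braid_of_word v <-> braid_equiv u v.
Proof.
by split=> [/eqmodP/asboolP //|uv]; apply/eqmodP; apply/asboolP.
Qed.

Lemma braid_of_word_repr n (a : braid n) : braid_of_word (repr a) = a.
Proof. exact: reprK. Qed.

Lemma braid_equiv_repr n (u : braid_word n) :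
  braid_equiv (repr (braid_of_word u)) u.
Proof. by apply/braid_of_wordP; rewrite braid_of_word_repr. Qed.

Definition braid_word_inv (n : nat) (u : braid_word n) : braid_word n :=
  rev [seq (x.1, ~~ x.2) | x <- u].

Lemma braid_word_inv_cat n (u v : braid_word n) :
  braid_word_inv (u ++ v) = braid_word_inv v ++ braid_word_inv u.
Proof. by rewrite /braid_word_inv map_cat rev_cat. Qed.

Lemma braid_word_invK n : involutive (@braid_word_inv n).
Proof.
move=> u; rewrite /braid_word_inv map_rev revK -map_comp -[RHS]map_id.
by apply: eq_map => -[i b] /=; rewrite negbK.
Qed.

Lemma braid_equiv_mulwV n (u : braid_word n) :
  braid_equiv (u ++ braid_word_inv u) [::].
Proof.
elim: u => [|[i b] u IHu]; first exact: BraidRefl.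
rewrite -cat1s braid_word_inv_cat -!catA.
apply: (@BraidTrans _ _ ([:: (i, b)] ++ braid_word_inv [:: (i, b)])).
  apply: BraidCat; first exact: BraidRefl.
  rewrite catA -[X in braid_equiv _ X]cat0s.
  by apply: BraidCat => //; exact: BraidRefl.
exact: BraidCancel.
Qed.

Lemma braid_equiv_mulVw n (u : braid_word n) :
  braid_equiv (braid_word_inv u ++ u) [::].
Proof.
by have := braid_equiv_mulwV (braid_word_inv u); rewrite braid_word_invK.
Qed.

Lemma braid_equiv_inv n (u v : braid_word n) :
  braid_equiv u v -> braid_equiv (braid_word_inv u) (braid_word_inv v).
Proof.
move=> uv; set u' := braid_word_inv u; set v' := braid_word_inv v.
have h1 : braid_equiv (u' ++ (v ++ v')) u'.
  rewrite -[X in braid_equiv _ X]cats0; apply: BraidCat; first exact: BraidRefl.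
  exact: braid_equiv_mulwV.
have h2 : braid_equiv (u' ++ (v ++ v')) v'.
  rewrite catA -[X in braid_equiv _ X]cat0s; apply: BraidCat; last first.
    exact: BraidRefl.
  apply: BraidTrans (braid_equiv_mulVw u).
  by apply: BraidCat; [exact: BraidRefl | exact: BraidSym].
exact: BraidTrans (BraidSym h1) h2.
Qed.

Definition braid_one (n : nat) : braid n := braid_of_word [::].
Definition braid_mul (n : nat) (a b : braid n) : braid n :=
  braid_of_word (repr a ++ repr b).
Definition braid_inv (n : nat) (a : braid n) : braid n :=
  braid_of_word (braid_word_inv (repr a)).

Lemma braid_mulE n (u v : braid_word n) :
  braid_mul (braid_of_word u) (braid_of_word v) = braid_of_word (u ++ v).
Proof. by apply/braid_of_wordP; apply: BraidCat; exact: braid_equiv_repr. Qed.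

Lemma braid_invE n (u : braid_word n) :
  braid_inv (braid_of_word u) = braid_of_word (braid_word_inv u).
Proof.
by apply/braid_of_wordP; apply: braid_equiv_inv; exact: braid_equiv_repr.
Qed.

Fact braid_mulA n : associative (@braid_mul n).
Proof.
move=> a b c; rewrite -[a]braid_of_word_repr -[b]braid_of_word_repr.
by rewrite -[c]braid_of_word_repr !braid_mulE catA.
Qed.

Fact braid_mul1g n : left_id (braid_one n) (@braid_mul n).
Proof. by move=> a; rewrite -[a]braid_of_word_repr braid_mulE. Qed.

Fact braid_mulg1 n : right_id (braid_one n) (@braid_mul n).
Proof. by move=> a; rewrite -[a]braid_of_word_repr braid_mulE cats0. Qed.

Fact braid_mulVg n : left_inverse (braid_one n) (@braid_inv n) (@braid_mul n).
Proof.
move=> a; rewrite -[a]braid_of_word_repr braid_invE braid_mulE.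
by apply/braid_of_wordP; exact: braid_equiv_mulVw.
Qed.

Fact braid_mulgV n : right_inverse (braid_one n) (@braid_inv n) (@braid_mul n).
Proof.
move=> a; rewrite -[a]braid_of_word_repr braid_invE braid_mulE.
by apply/braid_of_wordP; exact: braid_equiv_mulwV.
Qed.

HB.instance Definition _ n :=
  isGroup.Build (braid n) (@braid_mulA n) (@braid_mul1g n) (@braid_mulg1 n)
    (@braid_mulVg n) (@braid_mulgV n).

Definition braid_gen (n : nat) (i : 'I_n.-1) : braid n :=
  braid_of_word [:: (i, true)].

Lemma braid_gen_far n (i j : 'I_n.-1) : (i.+1 < j) || (j.+1 < i) ->
  braid_gen i * braid_gen j = braid_gen j * braid_gen i.
Proof.
by move=> ij; rewrite /mul /= !braid_mulE; apply/braid_of_wordP/BraidFar.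
Qed.

Lemma braid_gen_near n (i j : 'I_n.-1) : (i.+1 == j) || (j.+1 == i) ->
  braid_gen i * braid_gen j * braid_gen i
  = braid_gen j * braid_gen i * braid_gen j.
Proof.
by move=> ij; rewrite /mul /= /braid_gen !braid_mulE /=;
  apply/braid_of_wordP/BraidNear.
Qed.

Fact leq_pred2 m n : m <= n -> m.-1 <= n.-1.
Proof. by case: m n => [|m] [|n]. Qed.

Definition braid_word_emb (m n : nat) (le_mn : m <= n) (u : braid_word m) :
    braid_word n :=
  [seq (widen_ord (leq_pred2 le_mn) x.1, x.2) | x <- u].

Lemma braid_word_emb_equiv m n (le_mn : m <= n) (u v : braid_word m) :
  braid_equiv u v ->
  braid_equiv (braid_word_emb le_mn u) (braid_word_emb le_mn v).
Proof.
elim=> {u v} [u|u v _|u v w _ huv _|u u' v v' _ hu _|i b|i j ij|i j ij].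
- exact: BraidRefl.
- exact: BraidSym.
- exact: BraidTrans.
- by move=> hv; rewrite /braid_word_emb !map_cat; apply: BraidCat.
- exact: BraidCancel.
- exact: BraidFar.
- exact: BraidNear.
Qed.

Definition braid_emb (m n : nat) (le_mn : m <= n) (a : braid m) : braid n :=
  braid_of_word (braid_word_emb le_mn (repr a)).

Lemma braid_embE m n (le_mn : m <= n) (u : braid_word m) :
  braid_emb le_mn (braid_of_word u) = braid_of_word (braid_word_emb le_mn u).
Proof.
by apply/braid_of_wordP/braid_word_emb_equiv; exact: braid_equiv_repr.
Qed.

Fact braid_emb_morph m n (le_mn : m <= n) :
  monoid_morphism (@braid_emb m n le_mn).
Proof.
split=> [|a b]; first by rewrite braid_embE.
rewrite -[a]braid_of_word_repr -[b]braid_of_word_repr.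
by rewrite /mul /= !(braid_mulE, braid_embE) /braid_word_emb map_cat.
Qed.

HB.instance Definition _ m n (le_mn : m <= n) :=
  isUMagmaMorphism.Build (braid m) (braid n) (@braid_emb m n le_mn)
    (braid_emb_morph le_mn).

Lemma braid_emb_gen m n (le_mn : m <= n) (i : 'I_m.-1) :
  braid_emb le_mn (braid_gen i)
  = braid_gen (widen_ord (leq_pred2 le_mn) i).
Proof. exact: braid_embE. Qed.

Definition conjugate (G : groupType) (x y : G) : Prop :=
  exists g : G, y = x ^ g.

(* Main.v *)
(** A braid gives, for each of its strands, the braid obtained by deleting that
    strand; deletion is multiplicative once the endpoints of the deleted strand
    are tracked. Suppose [a g = g b] with [a], [b] on [m] strands and [g] on
    [m+1]. If the last strand of [g] ends in last position, deleting it
    conjugates [a] to [b]. Otherwise let that strand end at [i] and let the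
    strand of [g] ending in last position start at [j]. Write [a - j], [b - i]
    for the braids on [m-1] strands with one strand deleted. Deleting from
    [a g = g b] the strand starting last shows that [a] is conjugate to
    [b - i] plus a trivial strand; deleting the strand starting at [j] shows
    that [b] is conjugate to [a - j] plus a trivial strand; deleting both shows
    that [a - j] and [b - i] are conjugate. *)
Require Import Defs.
From mathcomp Require Import all_boot.
From mathcomp Require Import zify.

Set Implicit Arguments.
Unset Strict Implicit.
Unset Printing Implicit Defensive.

Local Open Scope group_scope.

(* Indexing generators by [nat], with the junk value [1] out of range, avoids
   casts between ordinal types. *)
Definition gen (n i : nat) : braid n :=
  if insub i is Some j then braid_gen j else 1.

Definition signed (G : groupType) (x : G) (b : bool) : G :=
  if b then x else x^-1.

Lemma genE n (i : 'I_n.-1) : gen n i = braid_gen i.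
Proof. by rewrite /gen valK. Qed.

Lemma gen_far n i j : i.+1 < j -> gen n i * gen n j = gen n j * gen n i.
Proof.
move=> ij; rewrite /gen; case: insubP => [i' _ ei|_]; last by rewrite mul1g mulg1.
case: insubP => [j' _ ej|_]; last by rewrite mul1g mulg1.
by apply: braid_gen_far; rewrite ei ej ij.
Qed.

Lemma gen_near n i : i.+1 < n.-1 ->
  gen n i * gen n i.+1 * gen n i = gen n i.+1 * gen n i * gen n i.+1.
Proof.
move=> lti; rewrite -[i in gen n i]/(val (Ordinal (ltnW lti))).
rewrite -[i.+1]/(val (Ordinal lti)) !genE.
by apply: braid_gen_near; rewrite /= eqxx.
Qed.

Lemma braid_of_word_cat n (u v : braid_word n) :
  braid_of_word (u ++ v) = braid_of_word u * braid_of_word v.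
Proof. by rewrite -braid_mulE. Qed.

Lemma braid_of_word_cons n (x : 'I_n.-1 * bool) (u : braid_word n) :
  braid_of_word (x :: u) = signed (gen n x.1) x.2 * braid_of_word u.
Proof.
case: x => i b; rewrite -cat1s braid_of_word_cat /= genE; congr (_ * _).
by case: b => //; exact: esym (braid_invE [:: (i, true)]).
Qed.

(** * Endpoint of a strand *)

(** The transposition of [i] and [i.+1]; both signs of a crossing permute endpoints alike, so no
    sign enters. *)
Definition cross (i p : nat) : nat :=
  if p == i then i.+1 else if p == i.+1 then i else p.

Definition wpos n (p : nat) (u : braid_word n) : nat :=
  foldl (fun q x => cross (x : 'I_n.-1 * bool).1 q) p u.

Lemma wpos_cat n p (u v : braid_word n) : wpos p (u ++ v) = wpos (wpos p u) v.
Proof. exact: foldl_cat. Qed.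

Ltac cross_cases := rewrite /cross /=; repeat case: ifP; lia.

Lemma crossK i : involutive (cross i).
Proof. by move=> p; cross_cases. Qed.

Lemma cross_lt n i p : i < n.-1 -> p < n -> cross i p < n.
Proof. by cross_cases. Qed.

Lemma wpos_lt n p (u : braid_word n) : p < n -> wpos p u < n.
Proof.
by elim: u p => //= [[i b] u IHu] p ltp; apply/IHu/cross_lt.
Qed.

Lemma wpos_equiv n (u v : braid_word n) :
  braid_equiv u v -> forall p, wpos p u = wpos p v.
Proof.
elim=> {u v} //=.
- by move=> u v w _ IH1 _ IH2 p; rewrite IH1.
- by move=> u u' v v' _ IH1 _ IH2 p; rewrite !wpos_cat IH1 IH2.
- by move=> i b p; rewrite crossK.
- by move=> i j ij p; move: ij; cross_cases.
- by move=> i j ij p; move: ij; cross_cases.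
Qed.

(** * Deletion of a strand *)

Definition gdel n (p i : nat) : braid n.-1 :=
  if (p == i) || (p == i.+1) then 1 else gen n.-1 (if p < i then i.-1 else i).

Fixpoint wdel n (p : nat) (u : braid_word n) : braid n.-1 :=
  if u is (i, b) :: v then signed (gdel n p i) b * wdel (cross i p) v else 1.

Lemma wdel_cat n p (u v : braid_word n) :
  wdel p (u ++ v) = wdel p u * wdel (wpos p u) v.
Proof.
elim: u p => [|[i b] u IHu] p /=; first by rewrite mul1g.
by rewrite IHu mulgA.
Qed.

(** Makes deletion compatible with cancelling a letter: the tracked strand meets the inverse letter
    at its other endpoint. *)
Lemma gdel_cross n p i : gdel n (cross i p) i = gdel n p i.
Proof.
rewrite /gdel; have -> : (cross i p < i) = (p < i) by cross_cases.
by have -> : (cross i p == i) || (cross i p == i.+1) = (p == i) || (p == i.+1)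
  by cross_cases.
Qed.

Lemma wdel_equiv n (u v : braid_word n) :
  braid_equiv u v -> forall p, p < n -> wdel p u = wdel p v.
Proof.
elim=> {u v}.
- by [].
- by move=> u v _ IH p ltp; rewrite IH.
- by move=> u v w _ IH1 _ IH2 p ltp; rewrite IH1 ?IH2.
- move=> u u' v v' eu IH1 _ IH2 p ltp; rewrite !wdel_cat IH1 //.
  by rewrite (wpos_equiv eu) IH2 ?wpos_lt.
- move=> i b p ltp /=; rewrite gdel_cross mulg1.
  by case: b; rewrite ?mulgV ?mulVg.
- move=> i j; wlog ij : i j / i.+1 < j => [IH|_ p ltp].
    by case/orP=> ij p ltp; [|symmetry]; apply: IH; rewrite ?ij.
  rewrite /= !mulg1 /gdel /cross.
  (* When [i.+1 < p < j], only [j] drops, and [i.+1 < j.-1] still holds. *)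
  repeat (case: ifP => //; try lia); rewrite ?mul1g ?mulg1 //;
    by move=> *; apply: gen_far; lia.
- move=> i j; wlog ij : i j / i.+1 = j :> nat => [IH|_ p ltp].
    by case/orP=> /eqP ij p ltp; [|symmetry]; apply: IH; rewrite ?ij ?eqxx.
  have := ltn_ord j; rewrite /= !mulg1 !mulgA -ij /gdel /cross => ltj.
  (* If the strand takes part, both sides reduce to [gen n.-1 i]; otherwise it runs left or right of
     all three strands. *)
  repeat (case: ifP => //; try lia); rewrite ?mul1g ?mulg1 //; move=> * /=.
    by have := @gen_near n.-1 i.-1; rewrite prednK; [apply; lia | lia].
  (* With the strand on the right, [p < n] gives [i.+1 < n.-1.-1]. *)
  by apply: gen_near; lia.
Qed.

(** * Deletion in the braid group *)

Definition pos n (p : nat) (x : braid n) : nat := wpos p (repr x).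

Definition del n (p : nat) (x : braid n) : braid n.-1 := wdel p (repr x).

Lemma pos_word n p (u : braid_word n) : pos p (braid_of_word u) = wpos p u.
Proof. exact: wpos_equiv (braid_equiv_repr u) p. Qed.

Lemma del_word n p (u : braid_word n) :
  p < n -> del p (braid_of_word u) = wdel p u.
Proof. exact: wdel_equiv (braid_equiv_repr u) p. Qed.

Lemma pos_lt n p (x : braid n) : p < n -> pos p x < n.
Proof. exact: wpos_lt. Qed.

Lemma pos1 n p : pos p (1 : braid n) = p.
Proof. exact: (pos_word p [::]). Qed.

Lemma posM n p (x y : braid n) : pos p (x * y) = pos (pos p x) y.
Proof.
rewrite -[x]braid_of_word_repr -[y]braid_of_word_repr -braid_of_word_cat.
by rewrite !pos_word wpos_cat.
Qed.

Lemma delM n p (x y : braid n) :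
  p < n -> del p (x * y) = del p x * del (pos p x) y.
Proof.
rewrite -[x]braid_of_word_repr -[y]braid_of_word_repr -braid_of_word_cat => ltp.
by rewrite pos_word !del_word ?wpos_lt // wdel_cat.
Qed.

Lemma posK n (x : braid n) : cancel (fun p => pos p x) (fun p => pos p x^-1).
Proof. by move=> p; rewrite -posM mulgV pos1. Qed.

Lemma posVK n (x : braid n) : cancel (fun p => pos p x^-1) (fun p => pos p x).
Proof. by move=> p; rewrite -posM mulVg pos1. Qed.

Lemma pos_gen n p i b : i < n.-1 -> pos p (signed (gen n i) b) = cross i p.
Proof.
move=> lti; have -> : signed (gen n i) b = braid_of_word [:: (Ordinal lti, b)].
  by rewrite braid_of_word_cons mulg1.
by rewrite pos_word.
Qed.

Lemma signed1 (G : groupType) b : signed (1 : G) b = 1.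
Proof. by case: b; rewrite //= invg1. Qed.

(** [unbump p] renumbers the other positions once [p] is removed; the claim holds crossing by
    crossing. *)
Lemma pos_del n p q (x : braid n) : p < n -> q < n -> p != q ->
  pos (unbump p q) (del p x) = unbump (pos p x) (pos q x).
Proof.
rewrite -[x]braid_of_word_repr => ltp ltq; rewrite del_word // !pos_word.
elim: (repr x) p q ltp ltq => {x} [|[i b] u IHu] p q ltp ltq neq_pq /=.
  by rewrite pos1.
rewrite posM -IHu ?cross_lt //; last by move: neq_pq; cross_cases.
congr (pos _ _); have := ltn_ord i; rewrite /gdel => lti.
case: ifP => [pi|pi].
  by rewrite signed1 pos1 /unbump; move: neq_pq pi; cross_cases.
rewrite pos_gen; last by move: pi; case: ifP; lia.
by move: neq_pq pi; rewrite /unbump; case: (ltnP p i); cross_cases.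
Qed.

(** * Endpoints and deletion under the embedding *)

Lemma pos_emb m p (a : braid m) : pos p (braid_emb (leqnSn m) a) = pos p a.
Proof.
rewrite -[a]braid_of_word_repr braid_embE !pos_word.
by elim: (repr a) p => //= -[i b] u IHu p; rewrite IHu.
Qed.

Lemma pos_emb_last m (a : braid m) : pos m (braid_emb (leqnSn m) a) = m.
Proof.
rewrite pos_emb -[a]braid_of_word_repr pos_word.
elim: (repr a) => //= -[i b] u IHu; rewrite -[RHS]IHu; congr (wpos _ _).
by have := ltn_ord i; cross_cases.
Qed.

(** The added strand lies right of every crossing, so its deletion drops no letter and shifts no
    index. *)
Lemma del_emb_last m (a : braid m) : del m (braid_emb (leqnSn m) a) = a.
Proof.
rewrite -[in RHS](braid_of_word_repr a) -[in LHS](braid_of_word_repr a).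
rewrite braid_embE del_word //.
elim: (repr a) => //= -[i b] u IHu; have lti := ltn_ord i.
have -> : cross i m = m by cross_cases.
rewrite braid_of_word_cons IHu; have -> // : gdel m.+1 m i = gen m i.
by rewrite /gdel /=; repeat case: ifP; try lia.
Qed.

Lemma emb_gen m i b : i < m.-1 ->
  braid_emb (leqnSn m) (signed (gen m i) b) = signed (gen m.+1 i) b.
Proof.
move=> lti; have E : braid_emb (leqnSn m) (gen m i) = gen m.+1 i.
  rewrite -[i in LHS]/(val (Ordinal lti)) genE braid_emb_gen -genE.
  by congr (gen _ _).
by case: b; rewrite /= ?gmulfV /= E.
Qed.

Lemma del_emb k p (a : braid k.+1) : p < k.+1 ->
  del p (braid_emb (leqnSn k.+1) a) = braid_emb (leqnSn k) (del p a).
Proof.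
rewrite -[a]braid_of_word_repr braid_embE => ltp.
rewrite !del_word //; last exact: ltnW.
elim: (repr a) p ltp => {a} [|[i b] u IHu] p ltp /=; first by rewrite gmulf1.
have lti := ltn_ord i; rewrite gmulfM IHu ?cross_lt //; congr (_ * _).
rewrite /gdel /=; case: ifP => pi; first by rewrite !signed1 gmulf1.
rewrite emb_gen //; move: pi lti => /=; case: ifP; lia.
Qed.

(** * Conjugacy and added trivial strands *)

Lemma conjugateP (G : groupType) (x y : G) :
  conjugate x y <-> exists g, x * g = g * y.
Proof.
split=> -[g E]; exists g; first by rewrite E conjgC.
by rewrite conjgE E mulKg.
Qed.

Lemma conjugate_sym (G : groupType) (x y : G) : conjugate x y -> conjugate y x.
Proof. by case=> g ->; exists g^-1; rewrite conjgK. Qed.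

Lemma conjugate_trans (G : groupType) (x y z : G) :
  conjugate x y -> conjugate y z -> conjugate x z.
Proof. by case=> g -> [h ->]; exists (g * h); rewrite conjgM. Qed.

Lemma conjugate_emb_succ m (a b : braid m) :
  conjugate (braid_emb (leqnSn m) a) (braid_emb (leqnSn m) b) -> conjugate a b.
Proof.
case/conjugateP=> g E; move Ei: (pos m g) => i.
have lti : i <= m by rewrite -Ei; apply: (@pos_lt m.+1).
have Em : a * del m g = del m g * del i (braid_emb (leqnSn m) b).
  have := congr1 (del m) E; rewrite !delM //.
  by rewrite del_emb_last pos_emb_last Ei.
have [im|im] := eqVneq i m.
  by apply/conjugateP; exists (del m g); rewrite Em im del_emb_last.
case: m a b g E Ei lti Em im => [|k] a b g E Ei lti Em im; first by lia.
set j := pos k.+1 g^-1.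
have gj : pos j g = k.+1 by apply: posVK.
have ltj : j < k.+2 by apply: pos_lt.
have jk : k.+1 != j.
  by apply: contraNneq im => jk; rewrite -Ei [X in pos X]jk gj.
(* Both sides of [E] send [j] to the last position, as does [g] alone, and [g] acts injectively on
   positions. *)
have aj : pos j (braid_emb (leqnSn k.+1) a) = j.
  apply: (can_inj (posK g)) => /=.
  by have := congr1 (pos j) E; rewrite !posM gj pos_emb_last.
have Ej : del j (braid_emb (leqnSn k.+1) a) * del j g = del j g * b.
  by have := congr1 (del j) E; rewrite !delM // aj gj del_emb_last.
rewrite del_emb in Em; last by lia.
rewrite del_emb in Ej; last by lia.
(* Removing the end [i < k.+1] lowers the last end to [k]; the start [j < k.+1] keeps its number. *)
have jh : pos j (del k.+1 g) = k.
  have ub : unbump k.+1 j = j by rewrite /unbump; lia.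
  have ui : unbump i k.+1 = k by rewrite /unbump; lia.
  by have := pos_del g (ltnSn k.+1) ltj jk; rewrite -/j ub Ei gj ui.
(* In [del k.+1 g] the strand from [j] ends last, so it continues as the trivial strand of the
   embedded [del i b]. *)
have := congr1 (del j) Em; rewrite !delM; try lia.
rewrite -pos_emb aj jh del_emb_last => Eij.
(* The chain runs from [a] to [del i b] plus a strand, then [del j a] plus a strand, then [b]. *)
apply: (@conjugate_trans _ _ (braid_emb (leqnSn k) (del i b))).
  by apply/conjugateP; exists (del k.+1 g).
apply: (@conjugate_trans _ _ (braid_emb (leqnSn k) (del j a))).
  apply/conjugate_sym/conjugateP; exists (braid_emb (leqnSn k) (del j (del k.+1 g))).
  by rewrite -!gmulfM Eij.
by apply/conjugateP; exists (del j g).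
Qed.

Lemma braid_emb_trans m n p (mn : m <= n) (np : n <= p) (mp : m <= p)
    (a : braid m) : braid_emb np (braid_emb mn a) = braid_emb mp a.
Proof.
rewrite -[a]braid_of_word_repr !braid_embE; congr braid_of_word.
rewrite /braid_word_emb -map_comp; apply: eq_map => -[i b] /=.
by congr (_, _); apply: val_inj.
Qed.

Lemma braid_emb_id m (mm : m <= m) (a : braid m) : braid_emb mm a = a.
Proof.
rewrite -[a]braid_of_word_repr braid_embE; congr braid_of_word.
rewrite /braid_word_emb -[RHS]map_id; apply: eq_map => -[i b] /=.
by congr (_, _); apply: val_inj.
Qed.

(** The embedding factors into additions of one strand at a time. *)
Lemma conjugate_emb m n (le_mn : m <= n) (a b : braid m) :
  conjugate (braid_emb le_mn a) (braid_emb le_mn b) -> conjugate a b.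
Proof.
elim: n le_mn => [|n IHn] le_mn.
  by case: m le_mn a b => // le_mn a b; rewrite !braid_emb_id.
have [le_mn'|lt_nm] := leqP m n.
  rewrite -!(braid_emb_trans le_mn' (leqnSn n)) => /conjugate_emb_succ.
  exact: IHn.
have E : m = n.+1 by apply/eqP; rewrite eqn_leq le_mn.
by case: _ / E le_mn {IHn lt_nm} => le_mn; rewrite !braid_emb_id.
Qed.

Theorem theorem1p1 (m n : nat) (m_gt0 : 0 < m) (lt_mn : m < n)
    (a b : braid m) :
  conjugate (braid_emb (ltnW lt_mn) a) (braid_emb (ltnW lt_mn) b) ->
  conjugate a b.
Proof. exact: conjugate_emb. Qed.
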